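(* For every $n\in\mathbb{N}$, every perfect set $P\subset\mathbb{R}$, and every $n$-times differentiable function $f\colon\mathbb{R}\to\mathbb{R}$, there exists a $C^n$ function $g\colon\mathbb{R}\to\mathbb{R}$ for which the set $\{x\in\mathbb{R}\colon f(x)=g(x)\}\cap P$ is uncountable.
   Context: $\mathbb{N}=\{1,2,3,\ldots\}$. A perfect set is a non-empty closed subset of $\mathbb{R}$ with no isolated points. A $C^n$ function is an $n$-times differentiable function whose $n$th derivative is continuous. *)

(* Defs.v *)
From HB Require Import structures.
From mathcomp Require Import all_boot all_order all_algebra.
From mathcomp Require Import all_classical all_reals all_analysis.

Set Implicit Arguments.
Unset Strict Implicit.
Unset Printing Implicit Defensive.

Import Order.TTheory GRing.Theory Num.Theory.
Import numFieldNormedType.Exports.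

Local Open Scope classical_set_scope.
Local Open Scope ring_scope.

(* The library's [perfect_set] allows the empty set; here a perfect set is
   required to be non-empty. *)
Definition nonempty_perfect (R : realType) (P : set R) : Prop :=
  [/\ P !=set0, closed P & isolated P = set0].

(* [derive1n k f] is a total function, with junk values where the derivative
   does not exist, so differentiability of each of the first n iterated
   derivatives f, f', ..., f^(n-1) is required explicitly. *)
Definition n_times_differentiable (R : realType) (n : nat) (f : R -> R) : Prop :=
  forall k : nat, (k < n)%N -> forall x : R, derivable (derive1n k f) x 1.

Definition is_Cn (R : realType) (n : nat) (f : R -> R) : Prop :=
  n_times_differentiable n f /\ continuous (derive1n n f).

(* Main.v *)
(* The graph of f^(n) over P is an uncountable subset of the plane, so all but
   countably many x in P have points y in P, y <> x, with y close to x and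
   f^(n)(y) close to f^(n)(x), although f^(n) need not be continuous.
   Start from a C^n function G having the same n-jet as f at one such point and
   repeatedly pick a point x already treated and such a y near x. The jet of
   f - G vanishes at x, so by Taylor-Peano its j-th entry at y is
   o(|y - x|^(n - j)) for j < n, and it is small for j = n by the choice of y.
   Hence a truncated polynomial supported in the ball of radius |y - x| around
   y corrects the jet at y with a small change in C^n norm, and without
   touching the jets prescribed before. The limit g is C^n and agrees with f on
   the set of chosen points; if every chosen point is revisited infinitely
   often, the closure of this set is perfect, hence uncountable. *)
Require Import Defs.
From mathcomp Require Import all_boot all_order all_algebra.
From mathcomp Require Import all_classical all_reals all_analysis.
From mathcomp Require Import ring lra zify.
Import Order.TTheory GRing.Theory Num.Theory.
Import numFieldNormedType.Exports.
Local Open Scope classical_set_scope.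
Local Open Scope ring_scope.

Set Implicit Arguments.
Unset Strict Implicit.
Unset Printing Implicit Defensive.

(** * Real analysis: mean value estimates, Taylor-Peano, uniform limits *)

Lemma nested_intervals (R : realType) (a b : nat -> R) :
  (forall k, a k <= a k.+1) -> (forall k, b k.+1 <= b k) ->
  (forall k, a k <= b k) -> exists l, forall k, a k <= l <= b k.
Proof.
move=> ha hb hab.
have am m k : (m <= k)%N -> a m <= a k.
  by move=> /subnK <-; elim: (k - m)%N => [|i /le_trans]; [|apply; exact: ha].
have bm m k : (m <= k)%N -> b k <= b m.
  move=> /subnK <-; elim: (k - m)%N => [//|i ih].
  by rewrite addSn (le_trans (hb _)).
have ab m k : a m <= b k.
  rewrite (le_trans (am _ (maxn m k) (leq_maxl _ _)))//.
  by rewrite (le_trans (hab _))// bm// leq_maxr.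
exists (sup (range a)) => k; apply/andP; split.
  by apply: ub_le_sup; [exists (b 0%N) => _ [m _ <-]|exists k].
by apply: ge_sup; [exists (a 0%N), 0%N|move=> _ [m _ <-]].
Qed.

Lemma continuous_atP (R : realType) (f : R -> R) (x : R) :
  {for x, continuous f} <->
  forall e, 0 < e -> exists2 d, 0 < d &
    forall y, `|y - x| < d -> `|f y - f x| <= e.
Proof.
split=> [/cvgrPdist_le h e /h /nbhs_ballP[d /= d0 hd]|h].
  by exists d => // y yx; rewrite distrC; apply: hd; rewrite /ball/= distrC.
apply/cvgrPdist_le => e /h[d d0 hd]; apply/nbhs_ballP; exists d => //= y.
by rewrite /ball/= distrC => /hd; rewrite distrC.
Qed.

Lemma is_derive1P (R : realType) (f : R -> R) (x l : R) :
  is_derive x 1 f l <->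
  forall e, 0 < e -> exists2 d, 0 < d &
    forall y, `|y - x| < d -> `|f y - f x - l * (y - x)| <= e * `|y - x|.
Proof.
have quotE h : h != 0 ->
    `|l - h^-1 *: (f (h + x) - f x)| * `|h| = `|f (h + x) - f x - l * h|.
  move=> h0; rewrite -normrM -normrN; congr (`|_|); rewrite /GRing.scale/=.
  by field.
have scaleE (h : R) : h *: (1 : R) = h by rewrite /GRing.scale/= mulr1.
split=> [[df dfl] e e0|h].
  have : h^-1 *: ((f \o shift x) (h *: 1) - f x) @[h --> 0^'] --> l.
    by rewrite -dfl; exact: df.
  move=> /cvgrPdist_le/(_ _ e0)/nbhs_ballP[d /= d0 hd].
  exists d => // y yx; have [->|yNx] := eqVneq y x.
    by rewrite !subrr mulr0 subrr normr0 mulr0.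
  have yx0 : y - x != 0 by rewrite subr_eq0.
  have := hd (y - x); rewrite /ball/= sub0r normrN scaleE => /(_ yx yx0) hle.
  by rewrite -[X in f X](subrK x y) -quotE// ler_wpM2r.
have : h^-1 *: ((f \o shift x) (h *: 1) - f x) @[h --> 0^'] --> l.
  apply/cvgrPdist_le => e /h[d d0 hd]; apply/nbhs_ballP; exists d => //= t.
  rewrite /ball/= sub0r normrN scaleE => td t0.
  have := hd (t + x); rewrite addrK -quotE// => /(_ td).
  by rewrite ler_pM2r// normr_gt0.
move=> hl; split; first by apply/cvg_ex; exists l.
exact: cvg_lim hl.
Qed.

Lemma is_derive1_continuous (R : realType) (f : R -> R) (x l : R) :
  is_derive x 1 f l -> {for x, continuous f}.
Proof.
by move=> [df _]; apply/differentiable_continuous/derivable1_diffP.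
Qed.

Lemma lipschitz_of_derive (R : realType) (f df : R -> R) (x y c : R) :
  (forall z : R, is_derive z 1 f (df z)) ->
  (forall z, `|z - x| <= `|y - x| -> `|df z| <= c) ->
  `|f y - f x| <= c * `|y - x|.
Proof.
move=> fdf hc.
have hcont u v : {within `[u, v], continuous f}.
  apply: continuous_subspaceT => z; exact: is_derive1_continuous (fdf z).
have [xy|/ltW yx] := leP x y.
  have [z] := MVT_segment xy (fun z _ => fdf z) (hcont _ _).
  rewrite in_itv/= => /andP[xz zy] ->; rewrite normrM ler_wpM2r// hc//.
  by rewrite !ger0_norm ?subr_ge0// lerB.
have [z] := MVT_segment yx (fun z _ => fdf z) (hcont _ _).
rewrite in_itv/= => /andP[yz zx] eqf.
rewrite distrC eqf normrM [`|x - y|]distrC ler_wpM2r// hc//.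
by rewrite distrC [leRHS]distrC !ger0_norm ?subr_ge0// lerB.
Qed.

(* The Peano form of Taylor's theorem, for a function with vanishing jet. *)
Lemma flat_littleo (R : realType) (x : R) (m : nat) (D : nat -> R -> R) :
  (forall j (z : R), (j <= m)%N -> is_derive z 1 (D j) (D j.+1 z)) ->
  (forall j, (j <= m.+1)%N -> D j x = 0) ->
  forall e, 0 < e -> exists2 d, 0 < d &
    forall y, `|y - x| < d -> `|D 0%N y| <= e * `|y - x| ^+ m.+1.
Proof.
elim: m D => [|m ih] D hD D0 e e0.
  have /is_derive1P/(_ _ e0)[d d0 hd] := hD 0%N x isT.
  by exists d => // y /hd; rewrite !D0// subr0 mul0r subr0 expr1.
(* The shifted family is flat at [x] to one order less; the mean value inequality turns the bound on
   [D 1] into one on [D 0] with one more power of [|y - x|]. *)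
have [j z|j|d d0 hd] := ih (fun j => D j.+1) _ _ e e0.
- exact: (hD j.+1).
- exact: (D0 j.+1).
exists d => // y yx; rewrite -[D 0%N y]subr0 -(D0 0%N)// exprSr mulrA.
apply: (lipschitz_of_derive (fun z => hD 0%N z isT)) => z zx.
rewrite (le_trans (hd _ (le_lt_trans zx yx)))// ler_pM2l//.
by rewrite lerXn2r.
Qed.

(** Difference quotients of [h m - h k] are small uniformly in [m], so those of [h'] are close to
    those of one fixed [h k], whose differentiability at [x] supplies the rest. *)
Lemma derive_of_uniform_limit (R : realType) (h d : nat -> R -> R)
    (h' d' : R -> R) (eps : nat -> R) :
  (forall k (x : R), is_derive x 1 (h k) (d k x)) ->
  (forall k x, `|h' x - h k x| <= eps k) ->
  (forall k x, `|d' x - d k x| <= eps k) ->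
  (forall e, 0 < e -> exists k, forall m, (k <= m)%N -> eps m <= e) ->
  forall x : R, is_derive x 1 h' (d' x).
Proof.
move=> hd hh' dd' eps0 x; apply/is_derive1P => e e0.
have e4 : 0 < e / 4 by rewrite divr_gt0.
have [k hk] := eps0 _ e4.
have /is_derive1P/(_ _ e4)[dl dl0 hdl] := hd k x.
exists dl => // y yx; have [->|yNx] := eqVneq y x.
  by rewrite !subrr mulr0 subrr normr0 mulr0.
have yx0 : 0 < `|y - x| by rewrite normr_gt0 subr_eq0.
have Dle z : `|d' z - d k z| <= e / 4 by rewrite (le_trans (dd' _ _))// hk.
(* the mean value theorem for h m - h k, whose derivative is at most e / 2 *)
have hmk m : (k <= m)%N ->
    `|(h m y - h k y) - (h m x - h k x)| <= e / 2 * `|y - x|.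
  move=> km; apply: (@lipschitz_of_derive _ (h m - h k)
    (fun z => d m z - d k z)).
  move=> z _.
  have := Dle z; have := le_trans (dd' m z) (hk _ km).
  by rewrite !ler_norml => /andP[? ?] /andP[? ?]; apply/andP; split; lra.
have h'k : `|(h' y - h k y) - (h' x - h k x)| <= e / 2 * `|y - x|.
  (* Let [m] tend to infinity: replacing [h'] by [h m] costs at most [t / 2] at each of the two
     points. *)
  apply/ler_addgt0Pr => t t0.
  have t2 : 0 < t / 2 by rewrite divr_gt0.
  have [k' hk'] := eps0 _ t2; pose m := maxn k k'.
  have := hmk m (leq_maxl _ _).
  have := le_trans (hh' m y) (hk' m (leq_maxr _ _)).
  have := le_trans (hh' m x) (hk' m (leq_maxr _ _)).
  rewrite !ler_norml => /andP[? ?] /andP[? ?] /andP[? ?].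
  by apply/andP; split; lra.
have := hdl _ yx.
have : `|(d' x - d k x) * (y - x)| <= e / 4 * `|y - x|.
  by rewrite normrM ler_wpM2r.
move: h'k; rewrite !ler_norml => /andP[? ?] /andP[? ?] /andP[? ?].
by apply/andP; split; lra.
Qed.

Lemma continuous_of_uniform_limit (R : realType) (h : nat -> R -> R)
    (h' : R -> R) (eps : nat -> R) :
  (forall k, continuous (h k)) ->
  (forall k x, `|h' x - h k x| <= eps k) ->
  (forall e, 0 < e -> exists k, forall m, (k <= m)%N -> eps m <= e) ->
  continuous h'.
Proof.
move=> ch hh' eps0 x; apply/continuous_atP => e e0.
have e3 : 0 < e / 3 by rewrite divr_gt0.
have [k hk] := eps0 _ e3.
have /continuous_atP/(_ _ e3)[d d0 hd] := ch k x.
exists d => // y /hd; have := le_trans (hh' k y) (hk _ (leqnn _)).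
have := le_trans (hh' k x) (hk _ (leqnn _)).
rewrite !ler_norml => /andP[? ?] /andP[? ?] /andP[? ?].
by apply/andP; split; lra.
Qed.

Lemma half_exp_lt (R : realType) (e : R) :
  0 < e -> exists k, forall m, (k <= m)%N -> 2^-1 ^+ m < e.
Proof.
move=> e0; have : (2^-1 : R) ^+ k @[k --> \oo] --> 0.
  by apply: cvg_expr; rewrite ger0_norm ?invr_ge0// invf_lt1// ltr1n.
move=> /cvgrPdist_lt/(_ _ e0)[k _ hk]; exists k => m /hk.
by rewrite sub0r normrN ger0_norm// exprn_ge0// invr_ge0.
Qed.

(** * Uncountability and condensation points *)

(** Cantor's argument: given an injection [f] into the naturals, nested balls centred in [Q] are
    chosen so that the one made at step [k] misses the point with code [k]. Their common point lies
    in [Q] but can have no code. *)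
Lemma uncountable_dense_in_itself (R : realType) (Q : set R) :
  closed Q -> Q !=set0 ->
  (forall x e, Q x -> 0 < e -> exists y, [/\ Q y, y != x & `|y - x| < e]) ->
  ~ countable Q.
Proof.
move=> Qcl [x0 Qx0] Qacc /countable_injP[f finj].
(* The pair [ks.2] is a ball (centre, radius) and [F] picks the next one inside it; [(0, 0)] is a
   default outside the intended domain. *)
have /choice[F FP] : forall ks : nat * (R * R), exists s : R * R,
    Q ks.2.1 -> 0 < ks.2.2 -> [/\ Q s.1, 0 < s.2,
      `|s.1 - ks.2.1| + s.2 <= ks.2.2, s.2 <= ks.2.2 / 2 &
      forall z, Q z -> f z = ks.1 -> s.2 < `|z - s.1|].
  move=> [k [x r]] /=; have [Qx|] := pselect (Q x); last by exists (0, 0).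
  have [r0|] := ltP 0 r; last by exists (0, 0).
  have r4 : 0 < r / 4 by rewrite divr_gt0.
  (* The centre is first moved off the point with code [k]; the radius is then at most [r / 4], to
     stay inside the old ball, and at most half the distance to that point. *)
  have [y [Qy yx fy]] : exists y, [/\ Q y, `|y - x| < r / 4 & f y <> k].
    have [fx|fx] := pselect (f x = k); last first.
      by exists x; rewrite subrr normr0.
    have [y [Qy yNx yx]] := Qacc x _ Qx r4.
    exists y; split => //; rewrite -fx => /finj.
    by rewrite !inE => /(_ Qy Qx) yex; rewrite yex eqxx in yNx.
  have [[z [Qz fz]]|noz] := pselect (exists z, Q z /\ f z = k).
    have zy0 : 0 < `|z - y|.
      rewrite normr_gt0 subr_eq0; apply/negP => /eqP zy.
      by apply: fy; rewrite -zy.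
    exists (y, Num.min (r / 4) (`|z - y| / 2)) => _ _ /=; split => //.
    - by rewrite lt_min r4 divr_gt0.
    - have : Num.min (r / 4) (`|z - y| / 2) <= r / 4 by rewrite ge_min lexx.
      by move=> h; lra.
    - by rewrite ge_min; apply/orP; left; lra.
    - move=> w Qw fw; have -> : w = z by apply: finj; rewrite ?inE// fz.
      rewrite gt_min; apply/orP; right; lra.
  exists (y, r / 4) => _ _ /=; split => //; [lra|lra|].
  by move=> z Qz fz; case: noz; exists z.
pose u := fix u k := if k is k'.+1 then F (k', u k') else (x0, 1 : R).
have uP k : Q (u k).1 /\ 0 < (u k).2.
  by elim: k => [//|k [Qk rk]]; have [] := FP (k, u k) Qk rk.
have uS k : [/\ `|(u k.+1).1 - (u k).1| + (u k.+1).2 <= (u k).2,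
    (u k.+1).2 <= (u k).2 / 2 &
    forall z, Q z -> f z = k -> (u k.+1).2 < `|z - (u k.+1).1|].
  by have [Qk rk] := uP k; have [] := FP (k, u k) Qk rk.
have [k|k|k|l lP] := @nested_intervals R (fun k => (u k).1 - (u k).2)
  (fun k => (u k).1 + (u k).2) _ _ _.
- have [+ _ _] := uS k; have := ler_norm ((u k).1 - (u k.+1).1).
    by rewrite distrC => ? ?; lra.
- by have [+ _ _] := uS k; have := ler_norm ((u k.+1).1 - (u k).1); lra.
- by have [_] := uP k; lra.
have lu k : `|l - (u k).1| <= (u k).2 by rewrite ler_distl; exact: lP.
suff Ql : Q l.
  have [_ _ /(_ l Ql erefl)] := uS (f l).
  by rewrite ltNge lu.
have ule k : (u k).2 <= 2^-1 ^+ k.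
  elim: k => [//|k ih]; have [_ + _] := uS k => /le_trans; apply.
  by rewrite exprSr ler_pM2r// invr_gt0.
apply: Qcl => V /nbhs_ballP[e /= e0 eV].
have [k /(_ k (leqnn k)) hk] := half_exp_lt e0.
exists (u k).1; split; first by have [] := uP k.
by apply: eV; rewrite /ball/= (le_lt_trans (lu k))// (le_lt_trans (ule k)).
Qed.

(* No regularity of [h] is needed: the graph of [h] over [A] is an uncountable
   subset of the plane, hence contains its condensation points up to a
   countable set. *)
Lemma graph_condensation (R : realType) (A : set R) (h : R -> R) :
  ~ countable A -> exists B : set R, [/\ B `<=` A, B !=set0 &
    forall x e, B x -> 0 < e ->
      exists y, [/\ B y, y != x, `|y - x| < e & `|h y - h x| < e]].
Proof.
(* [box p] is the part of [A] whose graph points lie in the rational rectangle [p]. There are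
   countably many rectangles, so [bad] is countable. *)
move=> Anc; pose box (p : (rat * rat) * (rat * rat)) := [set y | [/\ A y,
  ratr p.1.1 < y < ratr p.1.2 & ratr p.2.1 < h y < ratr p.2.2]].
pose bad := \bigcup_(p in [set p | countable (box p)]) box p.
have cbad : countable bad by apply: bigcup_countable => //; exact: countableP.
have csub (C D : set R) : C `<=` D -> countable D -> countable C.
  by move=> /subset_card_le; exact: sub_countable.
exists (A `\` bad); split.
- by move=> x [].
- apply: contrapT => B0; apply: Anc; apply: csub cbad => x Ax.
  by apply: contrapT => bx; apply: B0; exists x.
- move=> x e [Ax bx] e0.
  have ratl (t : R) : exists q : rat, t - e < ratr q < t.
    by have [|q] := @rat_in_itvoo R (t - e) t; [lra|rewrite in_itv; exists q].
  have ratu (t : R) : exists q : rat, t < ratr q < t + e.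
    by have [|q] := @rat_in_itvoo R t (t + e); [lra|rewrite in_itv; exists q].
  have [a /andP[a1 a2]] := ratl x; have [b /andP[b1 b2]] := ratu x.
  have [c /andP[c1 c2]] := ratl (h x); have [d /andP[d1 d2]] := ratu (h x).
  pose p := ((a, b), (c, d)).
  (* Since [x] is not in [bad], this box is uncountable, and so it contains a point outside [bad]
     and different from [x]. *)
  have pnc : ~ countable (box p).
    by move=> pc; apply: bx; exists p => //; split; rewrite // ?a2 ?c2.
  have /existsNP[y /not_implyP[[Ay /andP[ay yb] /andP[cy yd]]]] :
      ~ (box p `<=` bad `|` [set x]).
    move=> /csub hp; apply/pnc/hp.
    rewrite -bigcup2E; apply: bigcup_countable; first exact: countableP.
    by move=> [|[|i]] _ //=; exact: countable1.
  move=> /not_orP[bady /eqP yx]; exists y; split => //.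
    by rewrite ltr_distl; apply/andP; split; [exact: lt_trans ay|
      exact: lt_trans b2].
  by rewrite ltr_distl; apply/andP; split; [exact: lt_trans cy|
    exact: lt_trans d2].
Qed.

(** * Truncated polynomials with a prescribed jet *)

Definition truncp (R : realType) (q : {poly R}) (t : R) : R :=
  if `|t| <= 1 then q.[t] else 0.

(** Where [|x| = 1], the value and slope of [q] are both zero, so the polynomial piece and the zero
    piece fit together to first order. *)
Lemma is_derive_truncp (R : realType) (q : {poly R}) (x : R) :
  (forall t, `|t| = 1 -> q.[t] = 0 /\ q^`().[t] = 0) ->
  is_derive x 1 (truncp q) (truncp q^`() x).
Proof.
move=> q0; apply/is_derive1P => e e0; rewrite /truncp.
have /is_derive1P/(_ _ e0)[d d0 hd] := is_derive_poly q x.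
have [x1|x1|x1] := ltgtP `|x| 1.
- exists (Num.min d (1 - `|x|)); first by rewrite lt_min d0 subr_gt0.
  move=> y; rewrite lt_min => /andP[yd yx].
  have -> : `|y| <= 1.
    by have := ler_normD (y - x) x; rewrite subrK => h; lra.
  exact: hd.
- exists (`|x| - 1); first by rewrite subr_gt0.
  move=> y yx; rewrite ifF; last first.
    apply/negbTE; rewrite -ltNge; have := ler_normD (x - y) y.
    by rewrite subrK distrC => h; lra.
  by rewrite mul0r !subr0 normr0 mulr_ge0// ltW.
- exists d => // y yd; have := hd _ yd; have [-> ->] := q0 _ x1.
  case: ifPn => // _ _; by rewrite mul0r !subr0 normr0 mulr_ge0// ltW.
Qed.

(** Each derivative lowers the exponent of [w] by one and changes only the cofactor, hence the
    induction over all [p]. *)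
Lemma derivn_mulX_root (R : realType) (p w : {poly R}) (m j : nat) (t : R) :
  (j < m)%N -> w.[t] = 0 -> (p * w ^+ m)^`(j).[t] = 0.
Proof.
elim: j p m => [|j ih] p [//|m].
  by rewrite !hornerE => _ ->; rewrite expr0n/= mulr0.
rewrite ltnS => jm wt; rewrite derivSn.
have -> : (p * w ^+ m.+1)^`() = (p^`() * w + p * w^`() *+ m.+1) * w ^+ m.
  by rewrite derivM deriv_exp exprS/= -mulr_natr -[in RHS]mulr_natr; ring.
exact: ih.
Qed.

Definition norm1 (R : realType) (p : {poly R}) : R :=
  \sum_(k < size p) `|p`_k|.

Lemma norm1_ge0 (R : realType) (p : {poly R}) : 0 <= norm1 p.
Proof. exact: sumr_ge0. Qed.

Lemma horner_le_norm1 (R : realType) (p : {poly R}) (t : R) :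
  `|t| <= 1 -> `|p.[t]| <= norm1 p.
Proof.
move=> t1; rewrite horner_coef (le_trans (ler_norm_sum _ _ _))//.
by rewrite ler_sum// => k _; rewrite normrM normrX ler_piMr// exprn_ile1.
Qed.

(** A cut-off Taylor polynomial [Q] on the unit interval is rescaled to radius [r]. The bounds on
    [a] make its coefficients [O(eta * r ^+ n)]; the [j]-th derivative costs [r ^- j], at most
    [r ^- n] as [r <= 1]. Hence [M] depends on [n] only. *)
Lemma bump_with_jet (R : realType) (n : nat) : exists2 M : R, 0 < M &
  forall (y r eta : R) (a : nat -> R), 0 < r <= 1 ->
    (forall j, (j <= n)%N -> `|a j| <= eta * r ^+ (n - j)) ->
  exists c : nat -> R -> R,
    [/\ forall j (z : R), (j <= n)%N -> is_derive z 1 (c j) (c j.+1 z),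
        forall j, (j <= n)%N -> c j y = a j,
        forall j z, (j <= n)%N -> r <= `|z - y| -> c j z = 0 &
        forall j z, (j <= n)%N -> `|c j z| <= M * eta].
Proof.
pose w : {poly R} := 1 - 'X^(2 * n.+1).
(* The exponent makes derivatives of order up to [n.+1] vanish at 1 and -1, which differentiating
   [c n] requires. *)
pose W := w ^+ n.+2.
pose S j : R := \sum_(i < n.+1) norm1 (i`!%:R^-1 *: ('X^i * W))^`(j).
have S0 j : 0 <= S j by apply: sumr_ge0 => i _; exact: norm1_ge0.
pose M : R := 1 + \sum_(j < n.+1) S j.
have M0 : 0 < M by rewrite ltr_pwDl// sumr_ge0.
(* [W] is 1 up to terms of degree above [n], so multiplication by [W] preserves the [n]-jet at 0. *)
have [s Ws] : exists s, W = 1 + 'X^(2 * n.+1) * s.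
  rewrite /W; elim: n.+2 => [|m [s IH]].
    by exists 0; rewrite mulr0 addr0 expr0.
  by exists (s - 1 - 'X^(2 * n.+1) * s); rewrite exprS IH /w; ring.
exists M => // y r eta a /andP[r0 r1] ha.
have rN0 : r != 0 by rewrite gt_eqF.
pose P := \poly_(i < n.+1) (a i * r ^+ i / i`!%:R).
pose Q := P * W.
have Qroot j t : (j < n.+2)%N -> `|t| = 1 -> Q^`(j).[t] = 0.
  move=> jn t1; apply: derivn_mulX_root => //.
  rewrite /w !hornerE exprM; suff -> : t ^+ 2 = 1 by rewrite expr1n subrr.
  by rewrite -real_normK ?num_real// t1 expr1n.
have Qcoef j : (j <= n)%N -> Q^`(j).[0] = a j * r ^+ j.
  move=> jn; rewrite horner_coef0 coef_derivn addn0 ffactnn /Q Ws mulrDr mulr1.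
  rewrite coefD mulrCA coefXnM ifT; last by lia.
  rewrite addr0 coef_poly ltnS jn -[LHS]mulr_natr divfK//.
have Qle j t : (j <= n)%N -> `|t| <= 1 -> `|Q^`(j).[t]| <= M * eta * r ^+ n.
  move=> jn t1; have eta0 : 0 <= eta.
    by have := ha n (leqnn n); rewrite subnn mulr1; exact: le_trans.
  have -> : Q = \sum_(i < n.+1) (a i * r ^+ i) *: (i`!%:R^-1 *: ('X^i * W)).
    rewrite /Q /P poly_def mulr_suml; apply: eq_bigr => i _.
    by rewrite scalerA scalerAl.
  rewrite raddf_sum/= horner_sum (le_trans (ler_norm_sum _ _ _))//.
  have -> : M * eta * r ^+ n = eta * r ^+ n * M by ring.
  apply: (@le_trans _ _ (eta * r ^+ n * S j)).
    rewrite /S mulr_sumr ler_sum// => i _; rewrite derivnZ hornerZ normrM.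
    apply: ler_pM => //; last exact: horner_le_norm1.
    rewrite normrM normrX [`|r|]ger0_norm ?(ltW r0)//.
    have ile : (i <= n)%N by rewrite -ltnS.
    have -> : r ^+ n = r ^+ (n - i) * r ^+ i by rewrite -exprD subnK.
    by rewrite mulrA ler_pM2r ?exprn_gt0// ha.
  rewrite ler_wpM2l ?mulr_ge0 ?exprn_ge0 ?(ltW r0)//.
  rewrite /M (bigD1 (Ordinal (jn : j < n.+1)%N))//=.
  by rewrite addrCA lerDl addr_ge0// sumr_ge0.
pose c j (z : R) := r ^- j * truncp Q^`(j) ((z - y) / r).
have normE z : `|(z - y) / r| = `|z - y| / r.
  by rewrite normrM normfV [`|r|]gtr0_norm.
exists c; split.
- move=> j z jn.
  have affine : is_derive z 1 (fun z : R => (z - y) / r) r^-1.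
    apply/is_derive1P => e e0; exists 1 => // v _.
    have -> : (v - y) / r - (z - y) / r - r^-1 * (v - z) = 0 by ring.
    by rewrite normr0 mulr_ge0// ltW.
  have outer : is_derive ((z - y) / r) 1 (truncp Q^`(j))
      (truncp Q^`(j.+1) ((z - y) / r)).
    rewrite derivnS; apply: is_derive_truncp => t t1; rewrite -derivnS.
    by rewrite !Qroot//; lia.
  have comp := @is_derive1_comp R _ (fun z : R => (z - y) / r) z _ _
    outer affine.
  have := is_deriveZ (r ^- j) comp.
  move/is_derive_eq; apply; rewrite /c /GRing.scale/= exprSr invfM; ring.
- move=> j jn; rewrite /c subrr mul0r /truncp normr0 ler01 Qcoef//.
  by rewrite mulrC mulfK// expf_neq0.
- move=> j z jn; rewrite /c /truncp normE => rz.
  case: ifPn => [|_]; last by rewrite mulr0.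
  rewrite ler_pdivrMr// mul1r => zr.
  rewrite Qroot ?mulr0//; first by lia.
  have zyr : `|z - y| = r by apply/le_anti/andP.
  by rewrite normE zyr divff.
- move=> j z jn; rewrite /c normrM normfV normrX [`|r|]gtr0_norm//.
  have eta0 : 0 <= eta.
    by have := ha n (leqnn n); rewrite subnn mulr1; exact: le_trans.
  rewrite mulrC ler_pdivrMr ?exprn_gt0// /truncp.
  case: ifPn => [z1|_]; last first.
    by rewrite normr0 !mulr_ge0 ?exprn_ge0// ltW.
  rewrite (le_trans (Qle _ _ jn z1))// ler_wpM2l ?mulr_ge0 ?(ltW M0)//.
  by rewrite ler_wiXn2l ?(ltW r0).
Qed.

(** * Adding one interpolation point *)

Lemma common_radius (R : realType) (I : eqType) (s : seq I) (x : R)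
    (S : I -> R -> Prop) :
  (forall i, i \in s -> exists2 d, 0 < d & forall y, `|y - x| < d -> S i y) ->
  exists2 d, 0 < d & forall y, `|y - x| < d -> forall i, i \in s -> S i y.
Proof.
elim: s => [_|i s ih h]; first by exists 1.
have [d d0 hd] := h i (mem_head _ _).
have [|d' d'0 hd'] := ih.
  by move=> k ks; apply: h; rewrite in_cons ks orbT.
exists (Num.min d d'); first by rewrite lt_min d0.
move=> y; rewrite lt_min => /andP[yd yd'] k; rewrite in_cons.
by move=> /orP[/eqP ->|]; [exact: hd|exact: hd'].
Qed.

(** The correction is a bump around [y] of radius [|y - x|]. The chain [G] goes one derivative
    further than [phi], which makes [G n] continuous. *)
Lemma add_interpolation_point (R : realType) (n : nat) (phi : nat -> R -> R)
    (B : set R) (F : seq R) (G : nat -> R -> R) (x e : R) : (0 < n)%N ->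
  (forall j (z : R), (j < n)%N -> is_derive z 1 (phi j) (phi j.+1 z)) ->
  (forall x e, B x -> 0 < e ->
     exists y, [/\ B y, y != x, `|y - x| < e & `|phi n y - phi n x| < e]) ->
  (forall j (z : R), (j <= n)%N -> is_derive z 1 (G j) (G j.+1 z)) ->
  (forall z j, z \in F -> (j <= n)%N -> G j z = phi j z) ->
  x \in F -> B x -> 0 < e ->
  exists (y : R) (G' : nat -> R -> R), [/\ B y, y != x, `|y - x| < e &
    [/\ forall j (z : R), (j <= n)%N -> is_derive z 1 (G' j) (G' j.+1 z),
        forall z j, z \in rcons F y -> (j <= n)%N -> G' j z = phi j z &
        forall j z, (j <= n)%N -> `|G' j z - G j z| <= e]].
Proof.
move=> n0 hphi hB hG GF xF Bx e0.
have [M M0 bump] := bump_with_jet R n.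
pose eta := e / M; have eta0 : 0 < eta by rewrite divr_gt0.
have eta2 : 0 < eta / 2 by rewrite divr_gt0.
pose D j z := phi j z - G j z.
(* Orders below [n]: Taylor-Peano for the flat chain [D i], ..., [D n]. *)
have [d1 d10 hd1] : exists2 d, 0 < d & forall y, `|y - x| < d ->
    forall i, i \in iota 0 n -> `|D i y| <= eta * `|y - x| ^+ (n - i).
  apply: common_radius => i; rewrite mem_iota add0n => /andP[_ iltn].
  have -> : (n - i)%N = (n - i).-1.+1 by lia.
  apply: (@flat_littleo R x _ (fun j => D (j + i)%N)) => //.
  - move=> j z jn; have jin : (j + i < n)%N by lia.
    have H := is_deriveB (hphi _ z jin) (hG _ z (ltnW jin)).
    exact: H.
  - by move=> j jn; rewrite /D GF ?subrr//; lia.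
(* No point of [F] is closer to [y] than [x] is, so the bump vanishes on [F]. *)
have [d2 d20 hd2] : exists2 d, 0 < d & forall y, `|y - x| < d ->
    forall z, z \in F -> `|y - x| <= `|z - y|.
  apply: common_radius => z _; have [->|zx] := eqVneq z x.
    by exists 1 => // y _; rewrite distrC.
  have zx0 : 0 < `|z - x| by rewrite normr_gt0 subr_eq0.
  exists (`|z - x| / 2); first by rewrite divr_gt0.
  move=> y yx; have := ler_normD (z - y) (y - x).
  by rewrite addrA subrK => h; lra.
(* Order [n]: [G n y] and [phi n y] are each within [eta / 2] of the common value at [x], the first
   by continuity, the second by the choice of [y]. *)
have /continuous_atP/(_ _ eta2)[d3 d30 hd3] :=
  is_derive1_continuous (hG n x (leqnn n)).
pose d := Num.min (Num.min d1 d2)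
  (Num.min (Num.min d3 e) (Num.min 1 (eta / 2))).
have d0 : 0 < d by rewrite !lt_min d10 d20 d30 e0 ltr01 eta2.
have [y [By yNx]] := hB x d Bx d0.
rewrite !lt_min => /andP[/andP[y1 y2] /andP[/andP[y3 ye] /andP[yle1 _]]].
move=> /andP[_ /andP[_ /andP[_ phiy]]].
have r0 : 0 < `|y - x| by rewrite normr_gt0 subr_eq0.
have [||c [cD cy c0 cM]] := bump y `|y - x| eta (D^~ y).
- by rewrite r0 ltW.
- move=> j; rewrite leq_eqVlt => /orP[/eqP ->|jn].
    rewrite subnn expr0 mulr1 /D; have := hd3 _ y3; rewrite [G n x]GF//.
    move: phiy; rewrite ltr_norml !ler_norml => /andP[? ?] /andP[? ?].
    by apply/andP; split; lra.
  by apply: hd1 => //; rewrite mem_iota.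
exists y, (fun j => G j + c j); split => //; split.
- move=> j z jn; have H := is_deriveD (hG j z jn) (cD j z jn); exact: H.
- move=> z j + jn; rewrite mem_rcons in_cons fctE => /orP[/eqP ->|zF].
    by rewrite cy// /D addrC subrK.
  by rewrite c0// ?addr0 ?GF//; exact: hd2.
- move=> j z jn; rewrite fctE addrAC subrr add0r (le_trans (cM _ _ jn))//.
  by rewrite /eta mulrC divfK ?gt_eqF.
Qed.

(** * Passage to the limit *)

(** The increments from [k] on sum to at most [2 * 2^-1 ^+ k], so the intervals of this radius
    around [s k] are nested. *)
Lemma geometric_limit (R : realType) (s : nat -> R) :
  (forall k, `|s k.+1 - s k| <= 2^-1 ^+ k) ->
  exists l, forall k, `|l - s k| <= 2 * 2^-1 ^+ k.
Proof.
move=> hs; have [k|k|k|l lP] := @nested_intervals R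
  (fun k => s k - 2 * 2^-1 ^+ k) (fun k => s k + 2 * 2^-1 ^+ k) _ _ _.
- have := hs k; rewrite exprS mulrA divff ?pnatr_eq0// mul1r ler_norml.
  by move=> /andP[? ?]; lra.
- have := hs k; rewrite exprS mulrA divff ?pnatr_eq0// mul1r ler_norml.
  by move=> /andP[? ?]; lra.
- have : 0 <= (2^-1 : R) ^+ k by rewrite exprn_ge0// invr_ge0.
  by lra.
- by exists l => k; rewrite ler_distl; exact: lP.
Qed.

(* Every [i] is the 2-adic valuation of arbitrarily large integers, so that
   [logn 2] visits every index infinitely often. *)
Lemma logn2_cofinal (i m : nat) : exists2 k, (m <= k)%N & logn 2 k.+1 = i.
Proof.
exists (2 ^ i * m.*2.+1).-1.
  have : (0 < 2 ^ i)%N by rewrite expn_gt0.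
  by rewrite -muln2; move: (2 ^ i)%N => p p0; nia.
rewrite prednK ?muln_gt0 ?expn_gt0// lognM ?expn_gt0// pfactorK//.
by rewrite lognE/= dvdn2/= odd_double addn0.
Qed.

Lemma interpolating_Cn (R : realType) (n : nat) (phi : nat -> R -> R)
    (B : set R) : (0 < n)%N ->
  (forall j (z : R), (j < n)%N -> is_derive z 1 (phi j) (phi j.+1 z)) ->
  (forall x e, B x -> 0 < e ->
     exists y, [/\ B y, y != x, `|y - x| < e & `|phi n y - phi n x| < e]) ->
  B !=set0 ->
  exists (A : set R) (g : nat -> R -> R), [/\ A `<=` B, A !=set0,
    forall x e, A x -> 0 < e -> exists y, [/\ A y, y != x & `|y - x| < e],
    (forall j (z : R), (j < n)%N -> is_derive z 1 (g j) (g j.+1 z)) /\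
      continuous (g n) &
    forall x, A x -> phi 0%N x = g 0%N x].
Proof.
move=> n0 hphi hB [x0 Bx0].
(* A state is the list of points chosen so far with a function and its derivatives, whose jets agree
   with [phi] on the list. *)
pose inv (s : seq R * (nat -> R -> R)) := [/\ forall z, z \in s.1 -> B z,
  forall j (z : R), (j <= n)%N -> is_derive z 1 (s.2 j) (s.2 j.+1 z) &
  forall z j, z \in s.1 -> (j <= n)%N -> s.2 j z = phi j z].
have half0 k : 0 < (2^-1 : R) ^+ k by rewrite exprn_gt0// invr_gt0.
have /choice[step stepP] : forall ks : nat * (seq R * (nat -> R -> R)),
    exists t : R * (nat -> R -> R), let k := ks.1 in let s := ks.2 in
    let x := nth 0 s.1 (logn 2 k.+1) in
    inv s -> x \in s.1 ->
    [/\ inv (rcons s.1 t.1, t.2), t.1 != x, `|t.1 - x| < 2^-1 ^+ k &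
        forall j z, (j <= n)%N -> `|t.2 j z - s.2 j z| <= 2^-1 ^+ k].
  move=> [k s] /=; set x := nth _ _ _.
  have [[[sB sD sphi] xs]|h] := pselect (inv s /\ x \in s.1); last first.
    by exists (0, fun _ _ => 0) => ? ?; case: h.
  have [y [G [By yx yxk [GD Gphi GG]]]] := add_interpolation_point n0 hphi hB
    sD sphi xs (sB _ xs) (half0 k).
  exists (y, G) => _ _; split => //; split => // z.
  by rewrite mem_rcons in_cons => /orP[/eqP ->|/sB].
(* The initial function is a bump of radius 1: the powers of the radius are then 1, and [eta]
   dominates every jet entry. *)
have [s0 [inv0 s01]] : exists s, inv s /\ s.1 = [:: x0].
  have [M M0 bump] := bump_with_jet R n.
  pose eta := \sum_(j < n.+1) `|phi j x0|.
  have [||c [cD cx _ _]] := bump x0 1 eta (phi^~ x0).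
  - by rewrite ltr01 lexx.
  - move=> j jn; rewrite expr1n mulr1 /eta.
    by rewrite (bigD1 (Ordinal (jn : j < n.+1)%N))//= lerDl sumr_ge0.
  exists ([:: x0], c); split => //; split => //= z.
    by rewrite mem_seq1 => /eqP ->.
  by move=> j; rewrite mem_seq1 => /eqP -> /cx.
pose u := fix u k := if k is k'.+1 then
  let t := step (k', u k') in (rcons (u k').1 t.1, t.2) else s0.
(* The point revisited at step [k]. Its index is less than [k.+1], the length of the list, so the
   default 0 of [nth] never occurs. *)
pose par k := nth 0 (u k).1 (logn 2 k.+1).
have usz k : size (u k).1 = k.+1.
  by elim: k => [|k ih] /=; rewrite ?s01// size_rcons ih.
have parP k : par k \in (u k).1.
  by rewrite mem_nth// usz ltn_logl.
have uinv k : inv (u k).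
  by elim: k => [//|k ih]; have [] := stepP (k, u k) ih (parP k).
have uS k : exists y, [/\ (u k.+1).1 = rcons (u k).1 y, y != par k,
    `|y - par k| < 2^-1 ^+ k &
    forall j z, (j <= n)%N -> `|(u k.+1).2 j z - (u k).2 j z| <= 2^-1 ^+ k].
  have [_ ? ? ?] := stepP (k, u k) (uinv k) (parP k).
  by exists (step (k, u k)).1.
(* Lists grow only at the end, so an index keeps denoting the same point. *)
have unth m k i : (i <= m)%N -> (m <= k)%N -> nth 0 (u k).1 i = nth 0 (u m).1 i.
  move=> im /subnK <-; elim: (k - m)%N => [//|d ih]; rewrite addSn.
  have [y [-> _ _ _]] := uS (d + m)%N; rewrite nth_rcons usz ifT ?ih//.
  by rewrite ltnS (leq_trans im)// leq_addl.
have usub m k z : (m <= k)%N -> z \in (u m).1 -> z \in (u k).1.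
  move=> mk /(nthP 0)[i]; rewrite usz ltnS => im <-.
  by rewrite -(unth _ _ _ im mk) mem_nth// usz ltnS (leq_trans im).
have /choice[g' g'P] : forall jz : nat * R, exists l, (jz.1 <= n)%N ->
    forall k, `|l - (u k).2 jz.1 jz.2| <= 2 * 2^-1 ^+ k.
  move=> [j z] /=; have [jn|] := leqP j n; last by exists 0.
  have [|l lP] := @geometric_limit R (fun k => (u k).2 j z); last by exists l.
  by move=> k; have [y [_ _ _]] := uS k; exact.
pose g j z := g' (j, z).
have gP j k z : (j <= n)%N -> `|g j z - (u k).2 j z| <= 2 * 2^-1 ^+ k.
  by move=> jn; exact: (g'P (j, z)).
have eps0 (e : R) : 0 < e ->
    exists k, forall m, (k <= m)%N -> 2 * 2^-1 ^+ m <= e.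
  move=> e0; have [|k hk] := @half_exp_lt R (e / 2); first by rewrite divr_gt0.
  by exists k => m /hk h; lra.
exists [set z | exists k, z \in (u k).1], g; split.
- by move=> z [k zk]; have [uB _ _] := uinv k; exact: uB.
- by exists x0, 0%N; rewrite /= s01 mem_head.
- move=> x e [m xm] e0; have [N hN] := half_exp_lt e0.
  (* The index of [x] comes up again at some late step [k], which adds a new point within
     [2^-1 ^+ k] of [x]. *)
  have [k mNk kx] := logn2_cofinal (index x (u m).1) (maxn m N).
  have [y [uk yx yxk _]] := uS k.
  have parx : par k = x.
    rewrite /par kx (@unth m) ?nth_index//.
    - by rewrite -ltnS -(usz m) index_mem.
    - exact: leq_trans (leq_maxl _ _) mNk.
  rewrite parx in yx yxk; exists y; split => //.
    by exists k.+1; rewrite uk mem_rcons mem_head.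
  by rewrite (lt_trans yxk)// hN// (leq_trans (leq_maxr _ _) mNk).
- split.
    move=> j z jn; apply: (@derive_of_uniform_limit R (fun k => (u k).2 j)
      (fun k => (u k).2 j.+1) (g j) (g j.+1) (fun k => 2 * 2^-1 ^+ k)) => //.
    + by move=> k x; have [_ uD _] := uinv k; exact: uD (ltnW jn).
    + by move=> k x; exact: gP (ltnW jn).
    + by move=> k x; exact: gP.
  apply: (@continuous_of_uniform_limit R (fun k => (u k).2 n) (g n)
    (fun k => 2 * 2^-1 ^+ k)) => //; last by move=> k x; exact: gP.
  move=> k x; have [_ uD _] := uinv k.
  exact: is_derive1_continuous (uD n x _).
- move=> x [m xm]; apply/eqP; rewrite -subr_eq0 -normr_le0.
  apply/ler_addgt0Pr => e e0; rewrite add0r.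
  (* Once [x] is listed, every later approximant equals [phi 0] at [x]. *)
  have [N hN] := eps0 _ e0; have [_ _ uphi] := uinv (maxn m N).
  rewrite distrC -(uphi x 0%N)//; last exact: usub (leq_maxl _ _) xm.
  by rewrite (le_trans (gP _ _ _ _))// hN// leq_maxr.
Qed.

(** * From chains of derivatives to the theorem *)

Lemma derive1n_chain (R : realType) (n : nat) (g : nat -> R -> R) :
  (forall j (z : R), (j < n)%N -> is_derive z 1 (g j) (g j.+1 z)) ->
  forall j, (j <= n)%N -> derive1n j (g 0%N) = g j.
Proof.
move=> hg; elim=> [//|j ih] jn; rewrite derive1nS ih ?(ltnW jn)//.
by apply/funext => z; rewrite derive1E; have [] := hg j z jn.
Qed.

Lemma eq_on_closure (R : realType) (f g : R -> R) (A : set R) :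
  continuous f -> continuous g -> (forall x, A x -> f x = g x) ->
  forall x, closure A x -> f x = g x.
Proof.
move=> cf cg fg x xA; apply/eqP; rewrite -subr_eq0 -normr_le0.
apply/ler_addgt0Pr => e e0; rewrite add0r.
have e2 : 0 < e / 2 by rewrite divr_gt0.
have /continuous_atP/(_ _ e2)[d d0 hd] := cf x.
have /continuous_atP/(_ _ e2)[d' d'0 hd'] := cg x.
have dd0 : 0 < Num.min d d' by rewrite lt_min d0.
have [y [Ay]] := xA _ (nbhsx_ballx x _ dd0).
rewrite /ball/= distrC lt_min => /andP[/hd + /hd'].
rewrite (fg _ Ay) !ler_norml => /andP[? ?] /andP[? ?].
by apply/andP; split; lra.
Qed.

Unset Implicit Arguments.

Theorem theorem4p6 (R : realType) (n : nat) (hn : (0 < n)%N)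
    (P : set R) (hP : nonempty_perfect P)
    (f : R -> R) (hf : n_times_differentiable n f) :
  exists g : R -> R,
    is_Cn n g /\ ~ countable ([set x : R | f x = g x] `&` P).
Proof.
have [P0 Pcl Piso] := hP.
(* Without isolated points, [P] satisfies the accumulation condition of Cantor's argument. *)
have Punc : ~ countable P.
  apply: uncountable_dense_in_itself => // x e Px e0; apply: contrapT => noy.
  have : isolated P x.
    split; first by rewrite inE.
    exists (ball x e); first exact: nbhsx_ballx.
    apply/seteqP; split => [y [xy Py]|_ ->]; last by split; [exact: ballxx|].
    apply: contrapT => /eqP yx; apply: noy; exists y; split => //.
    by rewrite distrC.
  by rewrite Piso.
have fD j (z : R) : (j < n)%N ->
    is_derive z 1 (derive1n j f) (derive1n j.+1 f z).
  by move=> jn; split; [exact: hf|rewrite derive1nS derive1E].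
have [B [BP B0 Bacc]] := graph_condensation (derive1n n f) Punc.
have [A [g [AB A0 Aacc [gD gC] fg]]] := interpolating_Cn hn fD Bacc B0.
have gn := derive1n_chain gD.
exists (g 0%N); split.
  split; last by rewrite gn.
  by move=> k kn x; rewrite gn ?(ltnW kn)//; have [] := gD k x kn.
(* The chosen points are only countably many, so the closure of [A] is used: equality extends to it
   by continuity, and [P] contains it because [P] is closed. *)
have fgA : forall x, closure A x -> f x = g 0%N x.
  apply: eq_on_closure fg => x; exact: is_derive1_continuous (_ 0%N x hn).
have clAP : closure A `<=` P.
  rewrite (closure_id P).1//; apply: closureS; exact: subset_trans BP.
have clAacc x e : closure A x -> 0 < e ->
    exists y, [/\ closure A y, y != x & `|y - x| < e].
  move=> clx e0; have [a [Aa xa]] := clx _ (nbhsx_ballx x _ e0).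
  have [ax|ax] := eqVneq a x.
    have [y [Ay yx yxe]] := Aacc a e Aa e0; rewrite ax in yx yxe.
    by exists y; split => //; exact: subset_closure.
  exists a; split => //; first exact: subset_closure.
  by rewrite distrC.
have clA0 : closure A !=set0.
  by have [a Aa] := A0; exists a; exact: subset_closure.
move=> cnt.
apply: (uncountable_dense_in_itself (@closed_closure _ A) clA0 clAacc).
apply: sub_countable cnt; apply: subset_card_le => x clx.
by split; [exact: fgA|exact: clAP].
Qed.
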